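(* For every integer $n\ge 1$, $$\det\left(b(i+j,q)\right)_{i,j=0}^{n-1} = \frac{2^{n(n-1)} q^{\binom{n+1}{3}}}{\prod_{j=0}^{n-1}(-q;q)_j^2}.$$
   Context: Let $q$ be an indeterminate. Put $[n]_q=\frac{1-q^n}{1-q}$, $[n]_q!=[1]_q[2]_q\cdots[n]_q$, $\binom{n}{k}_q=\frac{[n]_q!}{[k]_q!\,[n-k]_q!}$ for $0\le k\le n$, and $(x;q)_n=\prod_{j=0}^{n-1}(1-q^jx)$, so that $(-q;q)_n=\prod_{j=1}^{n}(1+q^j)$. For $n\ge 0$ define the rational function $$b(n,q)=\binom{n}{\lfloor n/2\rfloor}_q\,\frac{2^n}{(-q;q)_{\lfloor n/2\rfloor}\,(-q;q)_{\lfloor (n+1)/2\rfloor}}.$$ *)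

(* Defs.v *)
From mathcomp Require Import all_boot all_order all_algebra.

Set Implicit Arguments.
Unset Strict Implicit.
Unset Printing Implicit Defensive.

Import GRing.Theory.
Local Open Scope ring_scope.

(* In a field, x / 0 = 0; the definitions below have their usual meaning when
   no denominator vanishes, which is the case for the indeterminate [qX]. *)
Definition qint (F : fieldType) (q : F) (n : nat) : F := (1 - q ^+ n) / (1 - q).

Definition qfact (F : fieldType) (q : F) (n : nat) : F :=
  \prod_(1 <= k < n.+1) qint q k.

(* Only meaningful for k <= n, since n - k is truncated. *)
Definition qbinom (F : fieldType) (q : F) (n k : nat) : F :=
  qfact q n / (qfact q k * qfact q (n - k)).

Definition qpoch (F : fieldType) (x q : F) (n : nat) : F :=
  \prod_(j < n) (1 - q ^+ j * x).

Definition b (F : fieldType) (n : nat) (q : F) : F :=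
  qbinom q n n./2 *
  (2%:R ^+ n / (qpoch (- q) q n./2 * qpoch (- q) q (n.+1)./2)).

(* The indeterminate q, as an element of the field Q(q). *)
Definition qX : {fraction {poly rat}} := tofrac 'X.

(* Main.v *)
Require Import Defs.
From mathcomp Require Import all_boot all_order all_algebra.
From mathcomp Require Import ring.

(** The Hankel matrix of the sequence [b] has an explicit factorization
    [L D L^T] with [L] unitriangular and [D] diagonal, and the determinant is
    the product of the diagonal of [D].

    The matrix [L] is a Stieltjes table: a triangular array [a n k] with
    [a 0 0 = 1] and
    [a n.+1 k = a n k.-1 + s k * a n k + t k * a n k.+1]
    (for [k = 0] the first term is absent).  The rows of such a table are the
    iterates of a tridiagonal operator which is self-adjoint for the weights
    [t 0 * ... * t (k - 1)], so the weighted inner product of rows [i] and [j]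
    depends on [i + j] only; it equals [a (i + j) 0].  Hence the column
    [a n 0] has Hankel determinants [\prod_(j < n) \prod_(l < j) t l]
    ([hankel_det_stieltjes]).

    For [b] the table is known in closed form.  With [P k = (-q; q)_k] and
    [w f e = [f + e]! / ([f]! P f [e]! P e)], it is
    [a n k = 2 ^ (n - k) * P k * w f (n - f)] where [f] is the integer part of
    [(n - k) / 2]; the column [k = 0] is [b n q] ([qtable_moment]).  Its
    recurrence, with [t k = 4 q^(k+1) / (1 + q^(k+1))^2], reduces for both
    parities of [n - k] to one identity of Pascal type, [qweight_pascal].
    Multiplying the [t l] gives the stated product ([prod_qoff]).

    All of this holds in any field for any [q] such that no positive power of
    [q] is [1], in particular for an indeterminate. *)

Set Implicit Arguments.
Unset Strict Implicit.
Unset Printing Implicit Defensive.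

Import GRing.Theory.
Local Open Scope ring_scope.

(** * Hankel determinants from Stieltjes tables *)

Section StieltjesTable.

Variables (R : comNzRingType) (s t : nat -> R) (a : nat -> nat -> R).

Hypothesis a00 : a 0 0 = 1.
Hypothesis a_triangular : forall n k, (n < k)%N -> a n k = 0.
Hypothesis aS0 : forall n, a n.+1 0 = s 0 * a n 0 + t 0 * a n 1.
Hypothesis aSS : forall n k,
  a n.+1 k.+1 = a n k + s k.+1 * a n k.+1 + t k.+1 * a n k.+2.

Let norm k := \prod_(l < k) t l.

Lemma stieltjes_diag n : a n n = 1.
Proof.
elim: n => [|n IHn]; first exact: a00.
by rewrite aSS IHn !a_triangular // !mulr0 !addr0.
Qed.

(** Self-adjointness of the tridiagonal operator up to a boundary term: the
    diagonal coefficients [s] cancel, and [norm k.+1 = norm k * t k] makes the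
    off-diagonal ones telescope. *)
Lemma stieltjes_christoffel_darboux N i j :
  \sum_(k < N.+1) norm k * (a i.+1 k * a j k - a i k * a j.+1 k) =
  norm N.+1 * (a i N.+1 * a j N - a i N * a j N.+1).
Proof.
elim: N => [|N IHN].
  rewrite big_ord_recl big_ord0 /norm big_ord0 big_ord_recl big_ord0 /= !aS0.
  by ring.
rewrite big_ord_recr /= IHN !aSS.
have -> : norm N.+2 = norm N.+1 * t N.+1 by rewrite /norm big_ord_recr.
by ring.
Qed.

(** Index units move from row [i] to row [j] one at a time: the boundary term of
    the Christoffel-Darboux sum vanishes as long as row [i] stops before [N],
    however long row [j] is.  This leaves row [0], which is [1, 0, 0, ...]. *)
Lemma stieltjes_gram N i j : (i <= N)%N ->
  \sum_(k < N.+1) norm k * (a i k * a j k) = a (i + j) 0.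
Proof.
elim: i j => [|i IHi] j ltiN.
  rewrite big_ord_recl big1 ?addr0 => [|k _].
    by rewrite /norm big_ord0 a00 !mul1r.
  by rewrite (a_triangular (n := 0)) // mul0r mulr0.
rewrite addSnnS -IHi ?(ltnW ltiN) //; apply/eqP; rewrite -subr_eq0 -sumrB.
under eq_bigr => k _ do rewrite -mulrBr.
rewrite stieltjes_christoffel_darboux !(a_triangular (n := i)) ?(leqW ltiN) //.
by rewrite !mul0r subrr mulr0.
Qed.

Lemma hankel_det_stieltjes n :
  \det (\matrix_(i < n, j < n) a (i + j) 0) = \prod_(j < n) \prod_(l < j) t l.
Proof.
case: n => [|n]; first by rewrite det_mx00 big_ord0.
pose L := \matrix_(i < n.+1, k < n.+1) a i k.
have detL : \det L = 1.
  rewrite det_trig; first by rewrite big1 // => i _; rewrite mxE stieltjes_diag.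
  by apply/is_trig_mxP => i k ltik; rewrite mxE a_triangular.
have -> : \matrix_(i < n.+1, j < n.+1) a (i + j) 0 =
    L *m diag_mx (\row_(k < n.+1) norm k) *m L^T.
  apply/matrixP => i j; rewrite mxE -(@stieltjes_gram n) ?leq_ord // mxE.
  by apply: eq_bigr => k _; rewrite mul_mx_diag !mxE; ring.
rewrite !det_mulmx det_tr detL mul1r mulr1 det_diag.
by apply: eq_bigr => k _; rewrite mxE.
Qed.

End StieltjesTable.

(** * The Stieltjes table of the central q-binomial sequence *)

Section QTable.

Variables (F : fieldType) (q : F).
Hypothesis q_generic : forall k, q ^+ k.+1 != 1.

Lemma subq_neq0 k : 1 - q ^+ k.+1 != 0.
Proof. by rewrite subr_eq0 eq_sym. Qed.

Lemma addq_neq0 k : 1 + q ^+ k.+1 != 0.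
Proof.
have : (1 - q ^+ k.+1) * (1 + q ^+ k.+1) != 0.
  rewrite (_ : _ * _ = 1 - q ^+ (k + k.+1).+1) ?subq_neq0 //.
  by rewrite -addSn exprD; ring.
by rewrite mulf_eq0 negb_or => /andP[].
Qed.

Let qminus k := qpoch (- q) q k.

Lemma qpoch0 : qminus 0 = 1.
Proof. by rewrite /qminus /qpoch big_ord0. Qed.

Lemma qpochS k : qminus k.+1 = qminus k * (1 + q ^+ k.+1).
Proof. by rewrite /qminus /qpoch big_ord_recr /= exprSr mulrN opprK. Qed.

Lemma qpoch_neq0 k : qminus k != 0.
Proof.
elim: k => [|k IHk]; first by rewrite qpoch0 oner_neq0.
by rewrite qpochS mulf_neq0 ?addq_neq0.
Qed.

Lemma qfactS k : qfact q k.+1 = qfact q k * qint q k.+1.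
Proof. by rewrite /qfact big_nat_recr. Qed.

Lemma qint_neq0 k : qint q k.+1 != 0.
Proof. by rewrite mulf_neq0 ?invr_eq0 ?subq_neq0 ?(subq_neq0 0). Qed.

Lemma qfact_neq0 k : qfact q k != 0.
Proof.
elim: k => [|k IHk]; first by rewrite /qfact big_geq ?oner_neq0.
by rewrite qfactS mulf_neq0 ?qint_neq0.
Qed.

(** The powers of [1 - q] cancel, and this is
    [(q; q)_(f+e) / ((q^2; q^2)_f (q^2; q^2)_e)]: a binomial coefficient in
    base [q^2] divided by [(-q; q)_(f+e)]. *)
Definition qweight f e : F :=
  qfact q (f + e) / (qfact q f * qminus f * (qfact q e * qminus e)).

Lemma qweightC f e : qweight f e = qweight e f.
Proof. by rewrite /qweight addnC [_ * (qfact q e * _)]mulrC. Qed.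

Lemma qweight0 e : qweight 0 e = (qminus e)^-1.
Proof.
rewrite /qweight add0n /qminus {1}/qpoch {2}/qfact big_ord0 big_geq //.
by rewrite !mul1r invfM mulrA divff ?mul1r ?qfact_neq0.
Qed.

Lemma qweightS f e : qweight f e.+1 =
  qweight f e * (1 - q ^+ (f + e).+1) / ((1 - q ^+ e.+1) * (1 + q ^+ e.+1)).
Proof.
have q1 : 1 - q != 0 := subq_neq0 0.
have := (subq_neq0 e, addq_neq0 e, qfact_neq0 f, qfact_neq0 e,
         qpoch_neq0 f, qpoch_neq0 e).
rewrite /qweight addnS !qfactS qpochS /qint.
move=> [[[[[? ?] ?] ?] ?] ?]; field.
by rewrite /=; do ?[apply/andP; split].
Qed.

Definition qentry k d : F := 2 ^+ d * qminus k * qweight d./2 (k + uphalf d).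

Definition qtable n k : F := if (k <= n)%N then qentry k (n - k) else 0.

(** For [k > 0] this is twice the number [s] characterized by
    [1 / (1 + q^k) + s = 1 / (1 + q^(k+1))], or equivalently by
    [s + q^(k+1) / (1 + q^(k+1)) = q^k / (1 + q^k)].  These two forms are what
    turns the three-term recurrence into a Pascal rule when [n - k] is even,
    resp. odd.  At [k = 0] the missing neighbour [a n (-1)] is a reflected copy
    of [a n 0], by the symmetry of [qweight], and is absorbed in the
    coefficient. *)
Definition qdiag k : F :=
  if k is k'.+1 then 2 * (1 - q) * q ^+ k / ((1 + q ^+ k) * (1 + q ^+ k.+1))
  else 2 / (1 + q).

Definition qoff k : F := 4 * q ^+ k.+1 / (1 + q ^+ k.+1) ^+ 2.

(** Dividing by [qweight f (k + f)] leaves a rational identity in [q], [q^k]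
    and [q^f]; it is the q-analogue of Pascal's rule in which the two terms are
    normalized by [1 + q^k]. *)
Lemma qweight_pascal k f :
  qweight f.+1 (k + f).+1 * (1 + q ^+ k) =
  qweight f.+1 (k + f) + q ^+ k * qweight f (k + f).+1.
Proof.
have := (subq_neq0 f, addq_neq0 f, subq_neq0 (k + f), addq_neq0 (k + f)).
rewrite qweightS (qweightC f.+1) !qweightS (qweightC (k + f)).
rewrite !exprS !exprD => -[[[? ?] ?] ?]; field.
by rewrite /=; do ?[apply/andP; split].
Qed.

(** The boundary case of [qweight_pascal], where the first index would become
    negative. *)
Lemma qweight0_pascal e : qweight 0 e.+1 * (1 + q ^+ e.+1) = qweight 0 e.
Proof. by rewrite !qweight0 qpochS invfM mulrVK // unitfE addq_neq0. Qed.

Lemma qtableE k d : qtable (k + d) k = qentry k d.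
Proof. by rewrite /qtable leq_addr addKn. Qed.

Lemma qtable_even k f :
  qtable (k + f.*2) k = 2 ^+ f.*2 * qminus k * qweight f (k + f).
Proof. by rewrite qtableE /qentry doubleK uphalf_double. Qed.

Lemma qtable_odd k f :
  qtable (k + f.*2).+1 k = 2 * 2 ^+ f.*2 * qminus k * qweight f (k + f).+1.
Proof.
by rewrite -addnS qtableE /qentry /= uphalf_double doubleK addnS exprS.
Qed.

Lemma qtable_triangular n k : (n < k)%N -> qtable n k = 0.
Proof. by rewrite /qtable ltnNge => /negbTE->. Qed.

Lemma qtable00 : qtable 0 0 = 1.
Proof.
by rewrite (qtableE 0 0) /qentry qweight0 expr0 mul1r mulfV ?qpoch_neq0.
Qed.

Lemma qtable_moment n : qtable n 0 = b n q.
Proof.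
rewrite -[n in LHS]add0n qtableE /qentry /b /qbinom /qweight add0n.
rewrite (_ : (n - n./2)%N = uphalf n); last first.
  by rewrite -{1}(odd_double_half n) -addnn addnA addnK uphalf_half.
have -> : (n./2 + uphalf n = n)%N.
  by rewrite addnC uphalf_half -addnA addnn odd_double_half.
have := (qfact_neq0 n./2, qfact_neq0 (uphalf n), qpoch_neq0 n./2,
         qpoch_neq0 (uphalf n)).
rewrite qpoch0 -!/(qminus _) /= => -[[[? ?] ?] ?]; field.
by rewrite /=; do ?[apply/andP; split].
Qed.

Lemma qtableS0 n :
  qtable n.+1 0 = qdiag 0 * qtable n 0 + qoff 0 * qtable n 1.
Proof.
have q1 : 1 + q != 0 := addq_neq0 0.
have m1 : qminus 1 = 1 + q by rewrite qpochS qpoch0 mul1r.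
rewrite /qdiag /qoff -(odd_double_half n).
move: (n./2) => f; case: (odd n) => /=.
  (* At [k = 0] both terms of the Pascal rule agree by symmetry. *)
  have := qweight_pascal 0 f; rewrite add0n expr0 mul1r (qweightC f.+1 f).
  rewrite -[1 + 1]/2 => pascal.
  have := qtable_even 0 f.+1; have := qtable_odd 0 f; have := qtable_even 1 f.
  rewrite doubleS !add1n !add0n qpoch0 m1 !exprS => -> -> ->.
  rewrite (_ : _ * _ * _ = 2 * 2 ^+ f.*2 * (qweight f.+1 f.+1 * 2));
    last by ring.
  by rewrite pascal; field.
have := qtable_odd 0 f; have := qtable_even 0 f.
rewrite !add0n qpoch0 => -> ->.
case: f => [|f].
  rewrite qtable_triangular // -[qweight 0 0]qweight0_pascal expr1.
  by field.
have := qtable_odd 1 f; have := qweight_pascal 1 f.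
rewrite doubleS !add1n m1 => pascal ->.
rewrite (canRL (mulfK q1) pascal) !exprS.
by field.
Qed.

Lemma qtableSS n k :
  qtable n.+1 k.+1 =
  qtable n k + qdiag k.+1 * qtable n k.+1 + qoff k.+1 * qtable n k.+2.
Proof.
have q1 := addq_neq0 k; have q2 := addq_neq0 k.+1.
have := ltngtP n k; case=> [ltnk|ltkn|->]; last first.
- rewrite (qtable_triangular (ltnSn k)) (qtable_triangular (leqnSn k.+1)).
  rewrite !mulr0 !addr0.
  have := qtable_even k 0; have := qtable_even k.+1 0.
  rewrite !addn0 => -> ->.
  by rewrite !qweight0 !mulrK // unitfE qpoch_neq0.
- rewrite -(subnKC ltkn) -(odd_double_half (n - k.+1)).
  move: (_./2) => f; case: (odd _).
    have := qtable_even k.+1 f.+1; have := qtable_even k f.+1.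
    have := qtable_odd k.+1 f; have := qtable_even k.+2 f.
    have := qweight_pascal k.+1 f.
    rewrite /qdiag /qoff /nat_of_bool add1n doubleS !addnS !addSn.
    rewrite !qpochS !exprS in q1 q2 *.
    move=> pascal -> -> -> ->; rewrite (canRL (mulfK q1) pascal).
    by field; apply/andP.
  have := qtable_odd k.+1 f; have := qtable_odd k f.
  have := qtable_even k.+1 f.
  rewrite /qdiag /qoff /nat_of_bool add0n.
  case: f => [|f].
    rewrite double0 !addn0 (qtable_triangular (ltnSn k.+1)) => -> -> ->.
    rewrite -(qweight0_pascal k.+1) !qpochS !exprS in q1 q2 *.
    by field; apply/andP.
  have := qtable_odd k.+2 f; have := qweight_pascal k.+2 f.
  rewrite doubleS !addnS !addSn !qpochS !exprS in q1 q2 * => pascal -> -> -> ->.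
  rewrite (canRL (mulfK q2) pascal).
  by field; apply/andP.
- by rewrite !qtable_triangular ?mulr0 ?addr0 ?ltnS // ltnW // ltnW.
Qed.

(** The exponent of [q] is a double hockey-stick sum:
    [\sum_(j < n) \sum_(l < j) l.+1 = \sum_(j < n) 'C(j.+1, 2)], which is
    ['C(n.+1, 3)]. *)
Lemma prod_qoff n : \prod_(j < n) \prod_(l < j) qoff l =
  2 ^+ (n * (n - 1))%N * q ^+ 'C(n.+1, 3) / \prod_(j < n) qminus j ^+ 2.
Proof.
have inner j : \prod_(l < j) qoff l = 4 ^+ j * q ^+ 'C(j.+1, 2) / qminus j ^+ 2.
  elim: j => [|j IHj]; first by rewrite big_ord0 qpoch0 expr1n invr1 !mulr1.
  rewrite big_ord_recr /= IHj /qoff (binS j.+1 1) bin1 exprD (exprS 4) qpochS.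
  by field; rewrite addq_neq0 qpoch_neq0.
elim: n => [|n IHn]; first by rewrite !big_ord0 invr1 !mulr1.
have den n0 : \prod_(j < n0) qminus j ^+ 2 != 0.
  by apply/prodf_neq0 => j _; rewrite expf_neq0 ?qpoch_neq0.
rewrite !big_ord_recr /= IHn inner (binS n.+1 2) exprD.
have -> : (n.+1 * (n.+1 - 1) = n * (n - 1) + 2 * n)%N.
  by rewrite subn1 /=; case: n {IHn} => // m;
    rewrite subn1 /= [(m.+1 * m)%N]mulnC -mulnDl addn2.
rewrite exprD (_ : 2 ^+ (2 * n) = 4 ^+ n :> F);
  last by rewrite exprM -natrX.
by field; rewrite den qpoch_neq0.
Qed.

Theorem hankel_det_b n :
  \det (\matrix_(i < n, j < n) b (i + j)%N q) =
  2 ^+ (n * (n - 1))%N * q ^+ 'C(n.+1, 3) / \prod_(j < n) qminus j ^+ 2.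
Proof.
rewrite -prod_qoff.
rewrite -(hankel_det_stieltjes qtable00 qtable_triangular qtableS0 qtableSS).
by congr (\det _); apply/matrixP => i j; rewrite !mxE qtable_moment.
Qed.

End QTable.

(** * The indeterminate *)

Lemma qX_generic k : qX ^+ k.+1 != 1.
Proof.
rewrite -tofracXn -tofrac1 tofrac_eq; apply/eqP.
move=> /(congr1 (fun p => size (p : {poly rat}))).
by rewrite size_polyXn size_poly1.
Qed.

Theorem mainTheorem7 (n : nat) (hn : (1 <= n)%N) :
  \det (\matrix_(i < n, j < n) b (i + j)%N qX) =
  2%:R ^+ (n * (n - 1))%N * qX ^+ 'C(n.+1, 3) /
    \prod_(j < n) qpoch (- qX) qX j ^+ 2.
Proof. exact: (hankel_det_b qX_generic). Qed.
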